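(* Let $F$ be a field of characteristic different from $2$. Then $$\nu_{2^\infty_F}=\begin{cases}\max\{k\in\mathbb{N}: F(\zeta_{2^k})=F(\zeta_4)\} & \text{when this maximum exists and } \zeta_4\notin F,\\ \ell_{2^\infty_F}+1 & \text{when } \zeta_4\in F\text{ and }\ell_{2^\infty_F}<\infty,\\ \infty & \text{otherwise.}\end{cases}$$ Moreover, $\nu_{2^\infty_F}=\infty$ if and only if either $\ell_{2^\infty_F}=\infty$, or $\ell_{2^\infty_F}=1$ and $F(\zeta_{2^k})=F(\zeta_4)$ for all integers $k\ge2$.
   Context: $\mathbb{N}=\{1,2,\dots\}$. $\zeta_n$ is a primitive $n$-th root of unity in a fixed algebraic closure of $F$. $\operatorname{o}_F(\alpha)$ is the least $k\ge1$ with $\alpha^k\in F$. For $e\in\mathbb{N}$: $\operatorname{t}_F(2^e)=2^e$ if $\operatorname{o}_F(\zeta_{2^e})>2$, $\operatorname{t}_F(2^e)=2$ if $\operatorname{o}_F(\zeta_{2^e})=2$, $\operatorname{t}_F(2^e)=1$ if $\zeta_{2^e}\in F$; $\operatorname{t}_F(1)=1$. $F$ has property $\mathcal{C}_2$ if there is $e\in\mathbb{N}$ with $\zeta_{2^e}\notin F$, $\operatorname{t}_F(2^e)\ne2$ and $\zeta_{2^e}-\zeta_{2^e}^{-1}\in F$. $\ell_{2^\infty_F}=\max\{k\in\mathbb{N}\cup\{0\}:\zeta_{2^k}\in F\}$ if it exists, $\infty$ otherwise. $\nu^+_{2^\infty_F}=\max\{k\in\mathbb{N}\cup\{0\}:\zeta_{\operatorname{t}_F(2^k)}+\zeta_{\operatorname{t}_F(2^k)}^{-1}\in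 F\}$ if it exists, $\infty$ otherwise. $\nu_{2^\infty_F}=\nu^+_{2^\infty_F}+1$ if $F$ has property $\mathcal{C}_2$, and $\nu_{2^\infty_F}=\nu^+_{2^\infty_F}$ otherwise. *)

(* Defs.v *)
From HB Require Import structures.
From mathcomp Require Import all_boot all_order all_algebra.
From mathcomp Require Import boolp classical_sets.

Set Implicit Arguments.
Unset Strict Implicit.
Unset Printing Implicit Defensive.

Import Order.TTheory GRing.Theory.

Local Open Scope classical_set_scope.
Local Open Scope ring_scope.

(* The algebraic closure of F is represented by a closed field L together with
   an embedding iota : F -> L over which L is algebraic, so that membership in
   F of an element of L is membership in [range iota]. *)
Definition algebraic_closure (F : fieldType) (L : closedFieldType)
    (iota : {rmorphism F -> L}) : Prop :=
  forall x : L, algebraicOver iota x.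

(* There is a primitive n-th root of unity in L only if n is nonzero in F;
   the other values of zeta are irrelevant.  The choices made for different n
   are not required to be compatible with each other. *)
Definition primitive_roots (L : closedFieldType) (zeta : nat -> L) : Prop :=
  forall n : nat, n%:R != 0 :> L -> n.-primitive_root (zeta n).

Definition is_max (A : set nat) (m : nat) : Prop :=
  A m /\ forall k, A k -> (k <= m)%N.

(* Elements of N u {0, oo} are encoded in [option nat], with [None] for oo;
   the successor [omap succn] fixes oo. *)
Definition max_or_oo (A : set nat) : option nat :=
  xget None [set Some m | m in is_max A].

Section KummerInvariants.
Variables (F : fieldType) (L : closedFieldType) (iota : {rmorphism F -> L}).
Variable zeta : nat -> L.

(* The subfield F(x) of L. *)
Definition adjoin (x : L) : set L :=
  smallest [set K : set L | divring_closed [in K]] (range iota `|` [set x]).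

(* The value is 0 when no power of x with positive exponent is in F, which
   does not happen for roots of unity. *)
Definition ordF (x : L) : nat :=
  xget 0%N [set k : nat | [/\ (0 < k)%N, x ^+ k \in range iota &
    forall j, (0 < j)%N -> x ^+ j \in range iota -> (k <= j)%N]].

(* Meaningful when n is a power of 2.  The last case is that of an order equal
   to 1, i.e., of zeta n in F. *)
Definition tF (n : nat) : nat :=
  if n == 1%N then 1%N
  else if (2 < ordF (zeta n))%N then n
  else if ordF (zeta n) == 2%N then 2%N
  else 1%N.

Definition property_C2 : Prop :=
  exists e : nat, [/\ (0 < e)%N, zeta (2 ^ e) \notin range iota,
    tF (2 ^ e) != 2%N & zeta (2 ^ e) - (zeta (2 ^ e))^-1 \in range iota].

Definition ell2 : option nat :=
  max_or_oo [set k : nat | zeta (2 ^ k) \in range iota].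

Definition nu2_plus : option nat :=
  max_or_oo [set k : nat |
    zeta (tF (2 ^ k)) + (zeta (tF (2 ^ k)))^-1 \in range iota].

Definition nu2 : option nat :=
  if `[< property_C2 >] then omap succn nu2_plus else nu2_plus.

End KummerInvariants.

(* Main.v *)
(** Write z_k for the chosen primitive 2^k-th root of unity and i = z_2.  Then
    t_F(2^k) is 1, 2 or 2^k according to whether z_k is in F, only its square
    is, or neither, so nu+ is the largest k with z_k^2 or z_k + 1/z_k in F.

    If i is in F, a trace z_k + 1/z_k in F forces z_k in F (a root y outside F
    with y^2 in F has y + 1/y outside F), so property C2 fails and nu = l + 1.

    If i is not in F and k >= 3, then F(z_k) = F(i) if and only if z_k + 1/z_k
    or z_k - 1/z_k is in F: the norm of z_k from F(i) is a root of unity of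
    2-power order in F, hence 1 or -1, so the conjugate of z_k is 1/z_k or
    -1/z_k.  Both cases for k imply the trace case for every smaller index, and
    they exclude each other.  Hence a difference in F can occur only at the
    largest k with F(z_k) = F(i), and it is the index that the correction by
    property C2 adds. *)

Require Import Defs.
From HB Require Import structures.
From mathcomp Require Import all_boot all_order all_algebra.
From mathcomp Require Import boolp classical_sets.
From mathcomp Require Import ring zify.

Set Implicit Arguments.
Unset Strict Implicit.
Unset Printing Implicit Defensive.

Import Order.TTheory GRing.Theory.

Local Open Scope classical_set_scope.
Local Open Scope ring_scope.

(** * Maxima of sets of naturals, with infinity as default *)

Lemma max_or_ooP (A : set nat) (m : nat) :
  max_or_oo A = Some m <-> is_max A m.
Proof.
rewrite /max_or_oo; split => [|mA].
  by case: xgetP => [o _ [n nA <-] [<-]|].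
case: xgetP => [_ -> [n [An leAn] <-]|/(_ (Some m))[]]; last by exists m.
case: mA => Am leAm; congr Some; apply/eqP.
by rewrite eqn_leq leAm // leAn.
Qed.

Lemma max_or_oo_None (A : set nat) :
  max_or_oo A = None <-> forall m, ~ is_max A m.
Proof.
split=> [ANone m /max_or_ooP|noA]; first by rewrite ANone.
case E: max_or_oo => [m|//].
by move/max_or_ooP: E => /noA.
Qed.

Lemma range_divring_closed (F L : fieldType) (iota : {rmorphism F -> L}) :
  divring_closed [in range iota].
Proof.
split=> [|x y|x y].
- by apply/mem_set; exists 1; rewrite ?rmorph1.
- move=> /set_mem[a _ <-] /set_mem[b _ <-]; apply/mem_set.
  by exists (a - b); rewrite ?rmorphB.
- move=> /set_mem[a _ <-] /set_mem[b _ <-]; apply/mem_set.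
  by exists (a / b); rewrite ?fmorph_div.
Qed.

(** * Simple extensions as least subfields *)

Section Adjoin.
Variables (F : fieldType) (L : closedFieldType) (iota : {rmorphism F -> L}).

Lemma adjoin_min (x : L) (M : set L) : divring_closed [in M] ->
  range iota `<=` M -> M x -> adjoin iota x `<=` M.
Proof.
move=> Mdiv FM Mx; apply: smallest_sub => // y [/FM//|/= ->//].
Qed.

Lemma adjoin_divring_closed (x : L) : divring_closed [in adjoin iota x].
Proof.
split=> [|y z|y z].
- by apply/mem_set => M [[M1 _ _] _]; apply: set_mem.
- move=> /set_mem yx /set_mem zx; apply/mem_set => M MP.
  have [Mdiv _] := MP; have [_ MB _] := Mdiv.
  by apply: set_mem; apply: MB; apply: mem_set; [apply: yx|apply: zx].
- move=> /set_mem yx /set_mem zx; apply/mem_set => M MP.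
  have [Mdiv _] := MP; have [_ _ MV] := Mdiv.
  by apply: set_mem; apply: MV; apply: mem_set; [apply: yx|apply: zx].
Qed.

Lemma sub_adjoin (x : L) : range iota `<=` adjoin iota x.
Proof. by move=> y Fy M [_ FM]; apply: FM; left. Qed.

Lemma mem_adjoin (x : L) : adjoin iota x x.
Proof. by move=> M [_ FM]; apply: FM; right. Qed.

Lemma eq_adjoin (x y : L) :
  adjoin iota x = adjoin iota y <-> adjoin iota y x /\ adjoin iota x y.
Proof.
split=> [E|[yx xy]]; first by split; [rewrite -E|rewrite E]; apply: mem_adjoin.
rewrite eqEsubset; split.
  by apply: (adjoin_min (@adjoin_divring_closed y) (@sub_adjoin y)).
by apply: (adjoin_min (@adjoin_divring_closed x) (@sub_adjoin x)).
Qed.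

End Adjoin.

(** * Traces x + 1/x and differences x - 1/x over a subfield *)

Section Subfield.
Variables (L : fieldType) (K : divringClosed L).
Implicit Types x y i a b c d : L.

Lemma root2_neq0 x n : x ^+ (2 ^ n) = 1 -> x != 0.
Proof.
apply: contra_eqN => /eqP ->.
by rewrite expr0n expn_eq0 /= eq_sym oner_eq0.
Qed.

(** The traces of the powers of x satisfy a two-term linear recurrence with coefficients x + 1/x and
    -1, so two consecutive ones are carried through the induction. *)
Lemma tr_exp_closed x n :
  x != 0 -> x + x^-1 \in K -> x ^+ n + (x ^+ n)^-1 \in K.
Proof.
move=> x0 trK.
suff: (x ^+ n + (x ^+ n)^-1 \in K) && (x ^+ n.+1 + (x ^+ n.+1)^-1 \in K).
  by case/andP.
elim: n => [|n /andP[IH IH1]]; first by rewrite expr0 expr1 invr1 rpredD ?rpred1.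
rewrite IH1 /=.
have -> : x ^+ n.+2 + (x ^+ n.+2)^-1 =
   (x + x^-1) * (x ^+ n.+1 + (x ^+ n.+1)^-1) - (x ^+ n + (x ^+ n)^-1).
  have xn0 : x ^+ n != 0 by rewrite expf_neq0.
  by rewrite !exprS; field; rewrite x0 xn0.
by rewrite rpredB ?rpredM.
Qed.

Lemma tr_sqr_closed x : x != 0 -> x - x^-1 \in K -> x ^+ 2 + (x ^+ 2)^-1 \in K.
Proof.
move=> x0 diffK.
have -> : x ^+ 2 + (x ^+ 2)^-1 = (x - x^-1) ^+ 2 + 1 + 1 by field.
by rewrite !rpredD ?rpredX ?rpred1.
Qed.

Lemma tr_diff_closed x : 2%:R != 0 :> L ->
  x + x^-1 \in K -> x - x^-1 \in K -> x \in K.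
Proof.
move=> two0 trK diffK.
have -> : x = ((x + x^-1) + (x - x^-1)) / 2%:R.
  by apply: (canRL (mulfK two0)); rewrite mulr_natr mulr2n addrACA subrr addr0.
by apply: rpred_div; [apply: rpredD|apply: rpred_nat].
Qed.

Lemma sqr_eqN1 i x : i ^+ 2 = -1 -> x ^+ 2 = -1 -> x = i \/ x = - i.
Proof.
move=> i2 x2; have : (x == i) || (x == - i) by rewrite -eqf_sqr i2 x2.
by case/orP=> /eqP; [left|right].
Qed.

(** Dividing y^2 + 1 by the trace recovers y; a zero trace means y^2 = -1, so y is i or -i. *)
Lemma sqr_tr_closed i y : i ^+ 2 = -1 -> i \in K -> y != 0 ->
  y ^+ 2 \in K -> y + y^-1 \in K -> y \in K.
Proof.
move=> i2 iK y0 y2K trK.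
have Ey : y ^+ 2 + 1 = (y + y^-1) * y by field.
have [c0|c0] := eqVneq (y + y^-1) 0.
  have /(sqr_eqN1 i2)[->//|->] : y ^+ 2 = -1; last by rewrite rpredN.
  by apply/eqP; rewrite -addr_eq0 Ey c0 mul0r.
have -> : y = (y ^+ 2 + 1) / (y + y^-1) by rewrite Ey mulrC mulKf.
by rewrite rpred_div // rpredD ?rpred1.
Qed.

(** Descent on the order: x^2 also has its trace in K, hence lies in K by induction, and
    [sqr_tr_closed] passes from x^2 to x. *)
Lemma tr_notin i x n : i ^+ 2 = -1 -> i \in K ->
  x ^+ (2 ^ n) = 1 -> x + x^-1 \in K -> x \in K.
Proof.
move=> i2 iK; elim: n x => [|n IHn] x xn trK.
  by rewrite -[x]expr1 xn rpred1.
have x0 := root2_neq0 xn.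
apply: (sqr_tr_closed i2) => //; apply: IHn; first by rewrite -exprM -expnS.
exact: tr_exp_closed.
Qed.

(** * The quadratic extension K(i) and its roots of unity *)

Section Gaussian.
Variable i : L.
Hypotheses (i2 : i ^+ 2 = -1) (iNK : i \notin K).

Definition gaussian : set L :=
  [set x | exists a b, [/\ a \in K, b \in K & x = a + b * i]].

Lemma gaussian_divring_closed : divring_closed [in gaussian].
Proof.
have i2' : i * i = -1 by rewrite -expr2.
split=> [|x y|x y].
- by apply/mem_set; exists 1, 0; rewrite rpred1 rpred0; split=> //; ring.
- move=> /set_mem[a [b [aK bK ->]]] /set_mem[c [d [cK dK ->]]]; apply/mem_set.
  by exists (a - c), (b - d); split; rewrite ?rpredB //; ring.
- move=> /set_mem[a [b [aK bK ->]]] /set_mem[c [d [cK dK ->]]]; apply/mem_set.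
  (* The inverse of 0 is 0, so a zero divisor gives the quotient 0. Otherwise the denominator is
     rationalized by the conjugate c - di. *)
  have [z0|z0] := eqVneq (c + d * i) 0.
    by exists 0, 0; rewrite rpred0 z0 invr0; split=> //; ring.
  have E : (c + d * i) * (c - d * i) = c ^+ 2 + d ^+ 2.
    have -> : (c + d * i) * (c - d * i) = c ^+ 2 - d ^+ 2 * (i * i) by ring.
    by rewrite i2'; ring.
  have z'0 : c - d * i != 0.
    apply: contraNneq z0 => z'0.
    (* If c = di, then either c and d both vanish or i = c/d lies in K. *)
    have [d0|d0] := eqVneq d 0.
      by move: z'0; rewrite d0 !mul0r subr0 => ->; rewrite addr0.
    case/negP: iNK; have -> : i = c / d by rewrite (subr0_eq z'0) mulrC mulKf.
    by rewrite rpred_div.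
  have N0 : c ^+ 2 + d ^+ 2 != 0 by rewrite -E mulf_neq0.
  have NK : c ^+ 2 + d ^+ 2 \in K by rewrite rpredD ?rpredX.
  exists ((a * c + b * d) / (c ^+ 2 + d ^+ 2)), ((b * c - a * d) / (c ^+ 2 + d ^+ 2)).
  split; rewrite ?rpred_div ?rpredD ?rpredN ?rpredM //.
  apply: (canLR (mulfK z0)); apply: (mulIf N0).
  transitivity (((a * c + b * d) + (b * c - a * d) * i) * (c + d * i)); last first.
    by field.
  ring: i2'.
Qed.

(* The powers of conjugates a + bi and a - bi are conjugate, and 1 is its
   own conjugate because i is not in K. *)
Lemma gaussian_conj_exp a b n : a \in K -> b \in K ->
  (a + b * i) ^+ n = 1 -> (a - b * i) ^+ n = 1.
Proof.
move=> aK bK.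
suff [c [d [cK dK -> ->]]] : exists c d, [/\ c \in K, d \in K,
    (a + b * i) ^+ n = c + d * i & (a - b * i) ^+ n = c - d * i].
  move=> cd1; have d0 : d = 0.
    apply/eqP; apply: contraNT iNK => d0.
    have -> : i = (1 - c) / d by rewrite -cd1 addrC addKr mulrC mulKf.
    by rewrite rpred_div ?rpredB ?rpred1.
  by rewrite -cd1 d0 !mul0r subr0 addr0.
elim: n => [|n [c [d [cK dK Ep Em]]]].
  by exists 1, 0; rewrite !expr0 mul0r addr0 subr0 rpred1 rpred0.
exists (a * c - b * d), (a * d + b * c).
split; rewrite ?rpredB ?rpredD ?rpredM // exprS ?Ep ?Em; ring: i2.
Qed.

(** By induction a^2 is 1 or -1, and -1 is not a square in K. *)
Lemma root2_mem a n : a \in K -> a ^+ (2 ^ n) = 1 -> a = 1 \/ a = -1.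
Proof.
elim: n a => [|n IHn] a aK; first by rewrite expn0 expr1; left.
rewrite expnS exprM => /(IHn _ (rpredX 2 aK))[/eqP|a2].
  by rewrite sqrf_eq1 => /orP[]/eqP; [left|right].
by case/negP: iNK; case: (sqr_eqN1 a2 i2) => ->; rewrite ?rpredN.
Qed.

(* The norm of x is a root of unity of 2-power order in K, hence 1 or -1. *)
Lemma gaussian_root2 x n : gaussian x -> x ^+ (2 ^ n) = 1 ->
  x + x^-1 \in K \/ x - x^-1 \in K.
Proof.
move=> [a [b [aK bK ->]]] xn; have x'n := gaussian_conj_exp aK bK xn.
have NE : (a + b * i) * (a - b * i) = a ^+ 2 + b ^+ 2 by ring: i2.
have aaK : a + a \in K by rewrite rpredD.
have x0 := root2_neq0 xn.
have [N1|N1] : a ^+ 2 + b ^+ 2 = 1 \/ a ^+ 2 + b ^+ 2 = -1.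
- apply: (@root2_mem _ n); first by rewrite rpredD ?rpredX.
  by rewrite -NE exprMn xn x'n mulr1.
- left; suff -> : (a + b * i)^-1 = a - b * i.
    by rewrite addrACA subrr addr0.
  by apply: (mulfI x0); rewrite mulfV // NE N1.
- right; suff -> : (a + b * i)^-1 = - (a - b * i).
    by rewrite opprK addrACA subrr addr0.
  by apply: (mulfI x0); rewrite mulfV // mulrN NE N1 opprK.
Qed.

End Gaussian.

Lemma quadratic_exp c e x n : c \in K -> e \in K -> x ^+ 2 = c * x + e ->
  exists a b, [/\ a \in K, b \in K & x ^+ n = a + b * x].
Proof.
move=> cK eK x2; elim: n => [|n [a [b [aK bK xn]]]].
  by exists 1, 0; rewrite rpred1 rpred0 mul0r addr0.
exists (b * e), (a + b * c); split; rewrite ?rpredD ?rpredM //.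
by rewrite exprS xn mulrDr mulrCA -expr2 x2; ring.
Qed.

End Subfield.

(** A named predicate, convertible to membership in [range iota], that can carry the subfield
    instance used by the [rpred] lemmas. *)
Definition image_field (F L : fieldType) (iota : {rmorphism F -> L}) : {pred L} :=
  [in range iota].

HB.instance Definition _ (F L : fieldType) (iota : {rmorphism F -> L}) :=
  GRing.isDivringClosed.Build L (image_field iota) (range_divring_closed iota).

(** * The chosen roots of unity of 2-power order *)

Section Invariants.
Variables (F : fieldType) (L : closedFieldType) (iota : {rmorphism F -> L}).
Variable zeta : nat -> L.
Hypothesis two_neq0 : 2%:R != 0 :> L.
Hypothesis zetaP : primitive_roots zeta.

Local Notation K := (image_field iota).
Local Notation z k := (zeta (2 ^ k)%N).

Lemma z_prim k : (2 ^ k)%N.-primitive_root (z k).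
Proof. by apply: zetaP; rewrite natrX expf_neq0. Qed.

Lemma z_expr k : z k ^+ (2 ^ k) = 1.
Proof. exact: prim_expr_order (z_prim k). Qed.

Lemma z_neq0 k : z k != 0.
Proof. exact: root2_neq0 (z_expr k). Qed.

Lemma z_power k y : y ^+ (2 ^ k) = 1 -> exists n, y = z k ^+ n.
Proof.
by move=> yk; have [n yn] := prim_rootP (z_prim k) yk; exists n.
Qed.

Lemma z_sub j k : (j <= k)%N -> exists n, z j = z k ^+ n.
Proof.
by move=> jk; apply: z_power; rewrite -(subnKC jk) expnD exprM z_expr expr1n.
Qed.

Lemma z0 : z 0 = 1.
Proof. by rewrite -(z_expr 0) expr1. Qed.

Lemma z1 : z 1 = -1.
Proof.
have : (z 1 == 1) || (z 1 == -1) by rewrite -sqrf_eq1 (z_expr 1).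
case/orP=> /eqP // z11.
by have := eq_prim_root_expr (z_prim 1) 1 0; rewrite !expr1 z11 expr0 eqxx.
Qed.

(** The choices of roots are independent, so the square of [z k.+1] need not be [z k]; both generate
    the same group. *)
Lemma zS_sqr k : exists n, z k = (z k.+1 ^+ 2) ^+ n.
Proof.
have : (2 ^ k)%N.-primitive_root (z k.+1 ^+ 2).
  have := dvdn_prim_root (z_prim k.+1) (dvdn_exp2l 2 (leqnSn k)).
  by rewrite expnS mulnK ?expn_gt0.
by move/prim_rootP=> /(_ _ (z_expr k))[n ->]; exists n.
Qed.

Lemma zS_sqr_mem k : (z k.+1 ^+ 2 \in K) = (z k \in K).
Proof.
apply/idP/idP => [z2K|zK]; first by have [n ->] := zS_sqr k; apply: rpredX.
have /z_power[n ->] : (z k.+1 ^+ 2) ^+ (2 ^ k) = 1.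
  by rewrite -exprM -expnS z_expr.
exact: rpredX.
Qed.

Lemma z4_sqr : zeta 4 ^+ 2 = -1.
Proof.
have [n zn] := zS_sqr 1; move: zn; rewrite z1 -[(2 ^ 2)%N]/4%N.
have : (zeta 4 ^+ 2 == 1) || (zeta 4 ^+ 2 == -1).
  by rewrite -sqrf_eq1 -exprM (z_expr 2).
case/orP=> /eqP // ->; rewrite expr1n => /eqP.
by rewrite eq_sym -addr_eq0 (negPf two_neq0).
Qed.

(** * Orders modulo F, and the invariants in terms of z_k *)

Lemma ordF_min (x : L) (k : nat) : (0 < k)%N -> x ^+ k \in K ->
  (forall j, (0 < j)%N -> x ^+ j \in K -> (k <= j)%N) -> ordF iota x = k.
Proof.
move=> k0 xk kmin; rewrite /ordF; case: xgetP => [m _ [m0 xm mmin]|/(_ k)[]//].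
by apply/eqP; rewrite eqn_leq mmin // kmin.
Qed.

(** The exponent k guarantees that the order is a true minimum and not the default 0. *)
Lemma ordF_gt2 (x : L) (k : nat) : (0 < k)%N -> x ^+ k \in K ->
  x \notin K -> x ^+ 2 \notin K -> (2 < ordF iota x)%N.
Proof.
move=> k0 xk xN x2N.
have ex : exists n, (0 < n)%N && (x ^+ n \in K) by exists k; rewrite k0.
have [m /andP[m0 xm] mmin] := ex_minnP ex.
rewrite (@ordF_min x m) // => [|j j0 xj]; last by apply: mmin; rewrite j0.
by case: m m0 xm {mmin} => [|[|[|m]]] // _; rewrite ?expr1 ?(negPf xN) ?(negPf x2N).
Qed.

Lemma tFE k : tF iota zeta (2 ^ k) =
  if z k \in K then 1%N else if z k ^+ 2 \in K then 2%N else (2 ^ k)%N.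
Proof.
rewrite /tF; have [zK|zN] := boolP (z k \in K).
  case: eqP => // _; rewrite (@ordF_min _ 1) ?expr1 //.
rewrite ifN; last by apply: contraNneq zN => ->; rewrite -[1%N]/(2 ^ 0)%N z0 rpred1.
have [z2K|z2N] := boolP (z k ^+ 2 \in K).
  rewrite (@ordF_min _ 2) // => -[|[|j]] //; by rewrite expr1 (negPf zN).
by rewrite (@ordF_gt2 _ (2 ^ k)) ?expn_gt0 // z_expr rpred1.
Qed.

(** When t_F is 1 or 2 the root in question is 1 or -1, whose trace is always in F; these are the
    indices with z_k^2 in F. *)
Lemma nu2_plusE : nu2_plus iota zeta =
  max_or_oo [set k | (z k ^+ 2 \in K) || (z k + (z k)^-1 \in K)].
Proof.
congr max_or_oo; apply/funext => k; apply/propext.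
change (zeta (tF iota zeta (2 ^ k)) + (zeta (tF iota zeta (2 ^ k)))^-1 \in K <->
  (z k ^+ 2 \in K) || (z k + (z k)^-1 \in K)).
rewrite tFE; have [zK|zN] := boolP (z k \in K).
  rewrite -[1%N]/(2 ^ 0)%N z0 rpredX //; split=> // _.
  by rewrite invr1 rpredD ?rpred1.
case: (boolP (z k ^+ 2 \in K)) => // z2K; split=> // _.
by rewrite -[2%N]/(2 ^ 1)%N z1 invrN invr1 rpredD ?rpredN1.
Qed.

Lemma property_C2E : property_C2 iota zeta <->
  exists e, z e ^+ 2 \notin K /\ z e - (z e)^-1 \in K.
Proof.
split=> [[e [e0 zN tN2 diffK]]|[e [z2N diffK]]]; exists e.
  split=> //; apply: contra tN2 => z2K.
  have zN' : z e \notin K by [].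
  by rewrite tFE (negPf zN') z2K.
have zN : z e \notin K by apply: contra z2N => zK; apply: rpredX.
split=> //; first by case: e z2N {diffK zN} => //; rewrite z0 expr1n rpred1.
rewrite tFE (negPf zN) (negPf z2N).
(* Here t_F(2^e) = 2^e, which equals 2 only for e = 1, and z_1 = -1 is in F. *)
apply: contraNneq zN; case: e {z2N diffK} => [//|[_|e /eqP]].
  by rewrite z1 rpredN1.
by rewrite -{2}[2%N]/(2 ^ 1)%N eqn_exp2l.
Qed.

Lemma tr_leq j k : (j <= k)%N -> z k + (z k)^-1 \in K -> z j + (z j)^-1 \in K.
Proof. by case/z_sub=> n ->; apply: tr_exp_closed (z_neq0 k). Qed.

(** Squaring the difference gives the trace of z_k^2, which generates the roots of index k - 1. *)
Lemma diff_tr j k : (j < k)%N -> z k - (z k)^-1 \in K -> z j + (z j)^-1 \in K.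
Proof.
case: k => // k jk /(tr_sqr_closed (z_neq0 k.+1)) trK.
apply: (@tr_leq j k jk); have [n ->] := zS_sqr k.
by apply: tr_exp_closed; rewrite ?expf_neq0 ?z_neq0.
Qed.

(** * The case of i in F *)

Section RootInBase.
Hypothesis iK : zeta 4 \in K.

Lemma tr_sqr_mem k : z k + (z k)^-1 \in K -> z k ^+ 2 \in K.
Proof.
by move=> trK; rewrite rpredX // (tr_notin z4_sqr iK (z_expr k) trK).
Qed.

(** A difference in F at index k + 1 gives a trace in F at k, hence z_k in F, and then the square of
    z_{k+1} is in F. *)
Lemma not_property_C2 : ~ property_C2 iota zeta.
Proof.
move=> /property_C2E[[|k] [z2N]]; first by rewrite z0 expr1n rpred1 in z2N.
move/(diff_tr (ltnSn k)) => trK; case/negP: z2N; rewrite zS_sqr_mem.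
exact: tr_notin z4_sqr iK (z_expr k) trK.
Qed.

Lemma nu2_Some m : nu2 iota zeta = Some m <->
  (0 < m)%N /\ ell2 iota zeta = Some m.-1.
Proof.
rewrite /nu2 asboolF; last exact: not_property_C2.
rewrite nu2_plusE /ell2 !max_or_ooP.
(* The shift by one between nu and l. At k = 0 the truncated predecessor is harmless, since z_0 =
   1. *)
have setE k : ((z k ^+ 2 \in K) || (z k + (z k)^-1 \in K)) = (z k.-1 \in K).
  case: k => [|k] /=; first by rewrite !z0 expr1n rpred1.
  apply/orP/idP => [|zK]; last by left; rewrite zS_sqr_mem.
  by rewrite -zS_sqr_mem; case=> // /tr_sqr_mem.
split=> [[]|].
  rewrite /= setE => zm mmax.
  have m0 : (0 < m)%N by apply: mmax; rewrite /= setE z0 rpred1.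
  split=> //; split=> // k zk; rewrite -ltnS prednK //.
  by apply: mmax; rewrite /= setE.
case: m => [[]//|m] [_ [/= zm mmax]]; split; first by rewrite /= setE.
move=> k; rewrite /= setE => /mmax; by case: k.
Qed.

End RootInBase.

(** * The case of i outside F *)

Section RootNotInBase.
Hypothesis iNK : zeta 4 \notin K.

Lemma ell2_Some1 : ell2 iota zeta = Some 1%N.
Proof.
apply/max_or_ooP; split=> [|k /= zk].
  by change (z 1 \in K); rewrite z1 rpredN1.
rewrite leqNgt; apply: contra iNK => /z_sub[n E].
by rewrite (_ : zeta 4 = z k ^+ n) //; apply: (@rpredX _ K).
Qed.

Lemma sqr_mem k : (z k ^+ 2 \in K) = (k <= 2)%N.
Proof.
apply/idP/idP => [|k2].
  case: k => // k; rewrite zS_sqr_mem => zk; rewrite ltnS leqNgt.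
  by apply: contra iNK => /z_sub[n E]; rewrite (_ : zeta 4 = z k ^+ n) // rpredX.
have [n ->] := z_sub k2; rewrite -[(2 ^ 2)%N]/4%N -exprM mulnC exprM z4_sqr.
by rewrite rpredX ?rpredN1.
Qed.

(* A quadratic polynomial over F kills x, and F(x) contains a power of x
   outside F, so that x is an affine function of that power. *)
Lemma adjoin_quadratic x c e n : c \in K -> e \in K -> x ^+ 2 = c * x + e ->
  zeta 4 = x ^+ n -> adjoin iota x = adjoin iota (zeta 4).
Proof.
move=> cK eK x2 xn; apply/eq_adjoin; split.
  have [a [b [aK bK E]]] := quadratic_exp n cK eK x2.
  have b0 : b != 0.
    by apply: contraNneq iNK => b0; rewrite xn E b0 mul0r addr0.
  have -> : x = (zeta 4 - a) / b by rewrite xn E addrC addKr mulrC mulKf.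
  have [_ DB DV] := @adjoin_divring_closed _ _ iota (zeta 4).
  have sub y : y \in K -> y \in adjoin iota (zeta 4).
    by move=> /(@set_mem _ (range iota)) Fy; apply: mem_set; apply: sub_adjoin.
  apply: set_mem; apply: DV; last exact: sub.
  by apply: DB; [apply: mem_set; apply: mem_adjoin|apply: sub].
move=> M MP; have [Mdiv _] := MP.
pose M' : divringClosed L :=
  HB.pack ([in M] : {pred L}) (GRing.isDivringClosed.Build L _ Mdiv).
have xM : x \in M' by apply: mem_set; apply: mem_adjoin MP.
by have := rpredX n xM; rewrite -xn => /(@set_mem _ M).
Qed.

(** One direction is the norm argument in F(i). Conversely, x^2 = (x + 1/x) x - 1 and x^2 = (x -
    1/x) x + 1 are quadratic equations over F as soon as the trace or the difference is in F. *)
Lemma adjoin_zE k : (0 < k)%N /\ adjoin iota (z k) = adjoin iota (zeta 4) <->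
  [&& (1 < k)%N & [|| k == 2%N, z k + (z k)^-1 \in K | z k - (z k)^-1 \in K]].
Proof.
split=> [[k0 /eq_adjoin[zk ik]]|/andP[k1 H]].
  have k1 : (1 < k)%N.
    (* Index 1 is excluded: F(-1) = F does not contain i. *)
    rewrite ltn_neqAle k0 andbT; apply: contra iNK => /eqP k1.
    apply: mem_set; apply: (adjoin_min (range_divring_closed iota) _ _ ik) => //.
    by rewrite -k1 z1; apply: set_mem; apply: (rpredN1 K).
  rewrite k1 /=; apply/orP; right.
  have zg : gaussian K (zeta 4) (z k).
    apply: (adjoin_min (gaussian_divring_closed z4_sqr iNK) _ _ zk).
      move=> x Fx; exists x, 0; rewrite mul0r addr0 rpred0; split=> //.
      exact: mem_set.
    by exists 0, 1; rewrite rpred0 rpred1 mul1r add0r.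
  by apply/orP; exact: (gaussian_root2 z4_sqr iNK zg (z_expr k)).
split; first exact: ltnW.
have [n zn] := z_sub k1.
have x0 := z_neq0 k.
case/or3P: H => [/eqP ->//|trK|diffK].
  apply: (@adjoin_quadratic _ (z k + (z k)^-1) (-1) n) => //; last by field.
  by rewrite rpredN1.
apply: (@adjoin_quadratic _ (z k - (z k)^-1) 1 n) => //; last by field.
by rewrite rpred1.
Qed.

(** [A] defines nu+. Under property C2, witnessed at e, its maximum is e - 1 while that of [S] is e;
    otherwise [A] and [S] agree from 2 on, and both contain 2. *)
Lemma is_max_adjoin m :
  is_max [set k | (0 < k)%N /\ adjoin iota (z k) = adjoin iota (zeta 4)] m <->
  nu2 iota zeta = Some m.
Proof.
set S := [set k | _]; have SE k : S k <-> _ := adjoin_zE k.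
rewrite /nu2 nu2_plusE; set A := [set k | _].
have AE k : A k <-> (k <= 2)%N || (z k + (z k)^-1 \in K) by rewrite /A /= sqr_mem.
have A_S k : (1 < k)%N -> A k -> S k.
  move=> k1 /AE; rewrite leq_eqVlt ltnS leqNgt k1 orbF => H.
  by apply/SE; rewrite k1; case/orP: H => ->; rewrite ?orbT.
have S2 : S 2%N by apply: A_S => //; apply/AE.
have A2 : A 2%N by apply/AE.
have [C2|C2] := pselect (property_C2 iota zeta).
  rewrite asboolT //; have /property_C2E[e [z2N diffK]] := C2.
  have e2 : (2 < e)%N by rewrite ltnNge -sqr_mem.
  have trN : z e + (z e)^-1 \notin K.
    apply: contra z2N => trK; apply: rpredX.
    exact: tr_diff_closed.
  have -> : max_or_oo A = Some e.-1.
    apply/max_or_ooP; split.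
      apply/AE; rewrite (diff_tr _ diffK) ?orbT // prednK //; exact: leq_trans e2.
    move=> k /AE /orP[k2|trK]; first by rewrite -ltnS prednK; lia.
    rewrite -ltnS prednK; last by lia.
    by rewrite ltnNge; apply: contra trN => /tr_leq; apply.
  have maxe : is_max S e.
    split; first by apply/SE; rewrite diffK !orbT andbT; lia.
    (* An index of [S] above e would put the trace of z_e in F, next to its difference. *)
    move=> k /SE/andP[k1 H]; rewrite leqNgt; apply: contra trN => ek.
    case/or3P: H => [|trK|dK]; first by lia.
      exact: tr_leq (ltnW ek) trK.
    exact: diff_tr ek dK.
  rewrite /= prednK; last by lia.
  split=> [[Sm mmax]|[<-]//]; case: maxe => Se emax.
  by congr Some; apply/eqP; rewrite eqn_leq emax // mmax.
rewrite asboolF // max_or_ooP.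
have S_A k : S k -> A k.
  case/SE/andP=> k1 /or3P[/eqP->//|trK|dK]; apply/AE; first by rewrite trK orbT.
  apply: contra_notT C2; rewrite negb_or -sqr_mem => /andP[z2N _].
  by apply/property_C2E; exists k.
split=> [[Sm mmax]|[Am mmax]].
  split=> [|k Ak]; first exact: S_A.
  by case: (ltnP 1 k) => [k1|]; [apply/mmax/A_S|have := mmax _ S2; lia].
split=> [|k Sk]; last by apply/mmax/S_A.
by apply: A_S => //; have := mmax _ A2; lia.
Qed.

(** The indices in question form an initial segment of the integers from 2 on, so without a maximum
    they exhaust them. *)
Lemma no_max_adjoin :
  (forall m, ~ is_max [set k | (0 < k)%N /\
      adjoin iota (z k) = adjoin iota (zeta 4)] m) <->
  forall k, (2 <= k)%N -> adjoin iota (z k) = adjoin iota (zeta 4).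
Proof.
split=> [nomax k|all m [[m0 Sm] mmax]]; last first.
  have := mmax m.+2; rewrite /= all // => /(_ (conj isT erefl)); lia.
case: k => [|[|k]] // _; elim: k => [//|k IHk].
apply: contra_notP (nomax k.+2) => Nk; split=> [//|j Sj].
rewrite leqNgt; apply/negP => kj; apply: Nk.
apply: proj2; apply/adjoin_zE => /=.
have /andP[j1 H] := (adjoin_zE j).1 Sj.
case/or3P: H => [|trK|dK]; first by lia.
  by rewrite (tr_leq kj trK).
move: kj; rewrite leq_eqVlt => /predU1P[->|kj]; first by rewrite dK orbT.
by rewrite (diff_tr kj dK).
Qed.

End RootNotInBase.

End Invariants.

Theorem theorem3p24 (F : fieldType) (charF : 2%N \notin [pchar F])
    (L : closedFieldType) (iota : {rmorphism F -> L})
    (Lclosure : algebraic_closure iota)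
    (zeta : nat -> L) (zetaP : primitive_roots zeta) :
  let S := [set k : nat | (0 < k)%N /\
              adjoin iota (zeta (2 ^ k)%N) = adjoin iota (zeta 4%N)] in
  [/\ forall m : nat, is_max S m -> zeta 4%N \notin range iota ->
        nu2 iota zeta = Some m,
      forall l : nat, zeta 4%N \in range iota -> ell2 iota zeta = Some l ->
        nu2 iota zeta = Some l.+1,
      ~ ((exists m : nat, is_max S m) /\ zeta 4%N \notin range iota) ->
        ~ (zeta 4%N \in range iota /\ ell2 iota zeta <> None) ->
        nu2 iota zeta = None
    & nu2 iota zeta = None <->
        (ell2 iota zeta = None \/
         (ell2 iota zeta = Some 1%N /\
          forall k : nat, (2 <= k)%N ->
            adjoin iota (zeta (2 ^ k)%N) = adjoin iota (zeta 4%N)))].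
Proof.
move=> S.
have two0 : 2%:R != 0 :> L.
  by move: charF; rewrite inE /= -(fmorph_eq0 iota) rmorph_nat.
have [iK|iN] := boolP (zeta 4%N \in range iota).
  have iK' : zeta 4%N \in image_field iota by [].
  have nuSome m := nu2_Some two0 zetaP iK' m.
  have nuNone : nu2 iota zeta = None <-> ell2 iota zeta = None.
    case: (nu2 iota zeta) nuSome => [m|] nuSome.
      by have [+ _] := nuSome m => /(_ erefl)[_ ->].
    case: (ell2 iota zeta) nuSome => [l|//] nuSome.
    by have [_ /(_ (conj isT erefl))] := nuSome l.+1.
  (* Since z_2 is in F, l cannot be 1, and the second alternative for nu infinite is void. *)
  have ellN1 : ell2 iota zeta <> Some 1%N.
    by move=> /max_or_ooP[_ /(_ 2%N iK')].
  split=> [//|l _ E|_ N|].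
  - by apply/nuSome.
  - by apply/nuNone; apply: contrapT => E; apply: N.
  - by rewrite nuNone; split=> [|[//|[]]]; [left|].
have iN' : zeta 4%N \notin image_field iota by [].
have nuSome m := is_max_adjoin two0 zetaP iN' m.
have nuNone : nu2 iota zeta = None <-> forall m, ~ is_max S m.
  split=> [E m /nuSome|nomax]; first by rewrite E.
  by case E: nu2 => [m|//]; move/nuSome: E => /nomax.
(* Now l = 1 is finite, so only the second alternative can hold. *)
have ell1 := ell2_Some1 two0 zetaP iN'.
split=> [m /nuSome//|l|N _|].
- by move=> iK; case/negP: iN'.
- by apply/nuNone => m maxm; apply: N; split=> //; exists m.
- rewrite nuNone (no_max_adjoin two0 zetaP iN') ell1; split=> [all|[//|[]//]].
  by right.
Qed.
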